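(* Let $(X,\mathcal{O}(X))$ be a measurable space, $\mathcal{A}$ a unital $C^*$-algebra, $\mathcal{H}$ a Hilbert space and $\mathcal{I}:\mathcal{O}(X)\to CP(\mathcal{A},\mathcal{B}(\mathcal{H}))$ a CP instrument. A function $f:X\to\mathcal{A}$ is strongly $\mathcal{I}$-measurable if and only if (1) $f$ is $\mathcal{I}$-essentially separably valued, i.e. for every $h,k\in\mathcal{H}$ there exists $A_{h,k}\in\mathcal{O}(X)$ with $\|\mathcal{I}_{h,k}\|(A_{h,k})=0$ and $f(X\setminus A_{h,k})$ is a separable subset of $\mathcal{A}$; and (2) $f$ is weakly $\mathcal{I}$-measurable.
   Context: A CP instrument is a map $\mathcal{I}:\mathcal{O}(X)\to CP(\mathcal{A},\mathcal{B}(\mathcal{H}))$ (completely positive linear maps) such that for all $h,k\in\mathcal{H}$, $a\in\mathcal{A}$ the set function $A\mapsto\langle h,\mathcal{I}(A)(a)k\rangle$ is a complex measure. $\mathcal{I}_{h,k}(A)(a)=\langle h,\mathcal{I}(A)(a)k\rangle$ defines an $\mathcal{A}^*$-valued vector measure $\mathcal{I}_{h,k}$. Semi-variation of a vector measure $\mu$ with values in a Banach space $\mathcal{B}$: $\|\mu\|(A)=\sup\{\sum_i|\varphi(\mu(E_i))|:\{E_1,\dots,E_n\}\text{ a measurable partition of }A,\ \varphi\in\mathcal{B}^*,\ \|\varphi\|\le1\}$. A property holds $\|\mu\|$-almost everywhere if it holds off a set $N\in\mathcal{O}(X)$ with $\|\mu\|(N)=0$. A simple function is $\sum_{i=1}^na_i1_{A_i}$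 with $a_i\in\mathcal{A}$, $A_i\in\mathcal{O}(X)$. $f:X\to\mathcal{A}$ is strongly $\mathcal{I}$-measurable if for every $h,k\in\mathcal{H}$ there is a sequence of simple functions $f_n^{h,k}:X\to\mathcal{A}$ with $\|f^{h,k}_n(x)-f(x)\|\to0$ for $\|\mathcal{I}_{h,k}\|$-almost every $x$. Strong $\mathcal{I}$-measurability of a scalar function is defined in the same way using scalar simple functions. $f$ is weakly $\mathcal{I}$-measurable if $a^*\circ f:X\to\mathbb{C}$ is strongly $\mathcal{I}$-measurable for every $a^*\in\mathcal{A}^*$. *)

(* Defs.v *)
From HB Require Import structures.
From mathcomp Require Import all_boot all_order all_algebra.
From mathcomp Require Import complex.
From mathcomp Require Import all_classical all_reals all_analysis.
From mathcomp Require Import ring lra.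

Set Implicit Arguments.
Unset Strict Implicit.
Unset Printing Implicit Defensive.

Import Order.TTheory GRing.Theory Num.Theory.
Import numFieldNormedType.Exports.

Local Open Scope classical_set_scope.
Local Open Scope ring_scope.
Local Open Scope complex_scope.

(* The norm of a normed space over [R[i]] is valued in [R[i]]; [rnorm] is the
   same number seen in [R]. *)
Definition rnorm (R : realType) (V : normedModType R[i]) (x : V) : R :=
  complex.Re `|x|.

Section rnorm_theory.
Context {R : realType} {V : normedModType R[i]}.
Implicit Types x y z : V.

Lemma rnormE x : (rnorm x)%:C = `|x|.
Proof. by rewrite /rnorm RRe_real// ger0_real. Qed.

Lemma rnorm_ge0 x : 0 <= rnorm x.
Proof. by rewrite -ler0c rnormE. Qed.

Lemma ler_rnormD x y : rnorm (x + y) <= rnorm x + rnorm y.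
Proof. by rewrite -lecR rmorphD/= !rnormE ler_normD. Qed.

Lemma rnormZ (c : R[i]) x : rnorm (c *: x) = rnorm (c : R[i]^o) * rnorm x.
Proof. by apply: complexI; rewrite rmorphM/= !rnormE normrZ. Qed.

Lemma rnorm0 : rnorm (0 : V) = 0.
Proof. by apply: complexI; rewrite rnormE normr0. Qed.

Lemma rnorm0_eq0 x : rnorm x = 0 -> x = 0.
Proof. by move=> x0; apply/eqP; rewrite -normr_eq0 -rnormE x0. Qed.

Lemma rnormN x : rnorm (- x) = rnorm x.
Proof. by rewrite /rnorm normrN. Qed.

Lemma rnorm_distC x y : rnorm (x - y) = rnorm (y - x).
Proof. by rewrite -opprB rnormN. Qed.

Lemma ler_rdistD y x z : rnorm (x - z) <= rnorm (x - y) + rnorm (y - z).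
Proof.
suff -> : x - z = (x - y) + (y - z) by exact: ler_rnormD.
by rewrite addrA subrK.
Qed.

End rnorm_theory.

Lemma rnorm_real_complex (R : realType) (r : R) :
  rnorm (r%:C : R[i]^o) = `|r|.
Proof. by rewrite /rnorm normc_def/= expr0n/= addr0 sqrtr_sqr. Qed.

Section bounded_operators.
Context {R : realType} (U V : normedModType R[i]).

Definition bounded_op_pred : {pred U -> V} :=
  [pred f | `[< linear f /\ continuous f >]].

Record bounded_op := BoundedOp {
  bounded_op_fun :> U -> V ;
  _ : bounded_op_fun \in bounded_op_pred }.

HB.instance Definition _ := [isSub for bounded_op_fun].
HB.instance Definition _ := [Choice of bounded_op by <:].

Lemma bounded_op_submod : submod_closed bounded_op_pred.
Proof.
split.
  apply/asboolP; split; last exact: cst_continuous.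
  by move=> c x y; rewrite /= scaler0 addr0.
move=> c f g /asboolP[lf cf] /asboolP[lg cg]; apply/asboolP; split.
  move=> b x y; rewrite [LHS]/(c *: f _ + g _) lf lg.
  rewrite [X in _ = _ *: X + _]/(c *: f x + g x) [X in _ = _ + X]/(c *: f y + g y).
  by rewrite !scalerDr !scalerA (mulrC c b) addrACA.
move=> x; apply: (@cvgD _ _ _ (nbhs x)); last exact: cg.
by apply: cvgZr; exact: cf.
Qed.

HB.instance Definition _ :=
  GRing.isSubmodClosed.Build R[i] (U -> V) bounded_op_pred bounded_op_submod.
HB.instance Definition _ := [SubChoice_isSubLmodule of bounded_op by <:].

Lemma bounded_op_linear (f : bounded_op) : linear f.
Proof. by case: f => f /= /asboolP[]. Qed.

Lemma bounded_op_continuous (f : bounded_op) : continuous f.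
Proof. by case: f => f /= /asboolP[]. Qed.

HB.instance Definition _ (f : bounded_op) :=
  GRing.isLinear.Build R[i] U V _ f (bounded_op_linear f).

Definition opnorm (f : bounded_op) : R :=
  sup [set rnorm (f x) | x in [set x : U | rnorm x <= 1]].

Lemma bounded_op_bound (f : bounded_op) :
  exists2 M : R, 0 <= M & forall x, rnorm (f x) <= M * rnorm x.
Proof.
have /linear_boundedP := (linear_bounded_continuous f).2 (@bounded_op_continuous f).
move=> /pinfty_ex_gt0[M M0 fM]; exists (complex.Re M).
  by rewrite -ler0c RRe_real ?gtr0_real ?ltW.
move=> x; rewrite -lecR rmorphM/= !rnormE RRe_real ?gtr0_real//.
exact: fM.
Qed.

Lemma opnorm_has_sup (f : bounded_op) :
  has_sup [set rnorm (f x) | x in [set x : U | rnorm x <= 1]].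
Proof.
split; first by exists (rnorm (f 0)), 0 => //=; rewrite rnorm0.
have [M M0 fM] := bounded_op_bound f; exists M => _ [x /= x1 <-].
by rewrite (le_trans (fM x))// ler_piMr.
Qed.

Lemma opnorm_ge (f : bounded_op) x : rnorm x <= 1 -> rnorm (f x) <= opnorm f.
Proof.
move=> x1; apply: ub_le_sup; last by exists x.
by case: (opnorm_has_sup f).
Qed.

Lemma opnorm_le (f : bounded_op) M :
  (forall x, rnorm x <= 1 -> rnorm (f x) <= M) -> opnorm f <= M.
Proof.
move=> fM; apply: ge_sup; first by case: (opnorm_has_sup f).
by move=> _ [x /= x1 <-]; exact: fM.
Qed.

Lemma opnorm_ge0 (f : bounded_op) : 0 <= opnorm f.
Proof.
by rewrite (le_trans (rnorm_ge0 (f 0)))// opnorm_ge// rnorm0 ler01.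
Qed.

Let norm (f : bounded_op) : R[i] := (opnorm f)%:C.

Let normD f g : norm (f + g) <= norm f + norm g.
Proof.
rewrite /norm -rmorphD/= lecR; apply: opnorm_le => x x1.
by rewrite (le_trans (ler_rnormD _ _))// lerD// opnorm_ge.
Qed.

Let opnormZ_le (c : R[i]) f : opnorm (c *: f) <= rnorm (c : R[i]^o) * opnorm f.
Proof.
apply: opnorm_le => x x1.
by rewrite [X in rnorm X](_ : _ = c *: f x)// rnormZ ler_wpM2l ?rnorm_ge0 ?opnorm_ge.
Qed.

Let normZ (c : R[i]) f : norm (c *: f) = `|c| * norm f.
Proof.
rewrite -[`|c|](@rnormE _ R[i]^o) /norm -rmorphM/=; congr (_%:C).
apply/eqP; rewrite eq_le opnormZ_le/=.
have [->|c0] := eqVneq c 0.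
  by rewrite (@rnorm0 _ R[i]^o) mul0r opnorm_ge0.
have rc0 : 0 < rnorm (c : R[i]^o).
  by rewrite -ltcR (@rnormE _ R[i]^o) normr_gt0.
have := opnormZ_le c^-1 (c *: f).
rewrite scalerA mulVf// scale1r => /(ler_wpM2l (ltW rc0)) /le_trans; apply.
suff rcV : rnorm (c : R[i]^o) * rnorm (c^-1 : R[i]^o) = 1.
  by rewrite mulrA rcV mul1r.
by apply: complexI; rewrite rmorphM/= !(@rnormE _ R[i]^o) -normrM mulfV// normr1.
Qed.

Let norm0_eq0 f : norm f = 0 -> f = 0.
Proof.
move=> /complexI f0; apply: val_inj; apply/funext => x /=.
have [->|x0] := eqVneq x 0; first by rewrite linear0.
have rx0 : 0 < rnorm x by rewrite -ltcR rnormE normr_gt0.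
have : rnorm (f ((rnorm x)^-1%:C *: x)) <= 0.
  rewrite -f0 opnorm_ge// rnormZ rnorm_real_complex.
  by rewrite ger0_norm ?invr_ge0 ?rnorm_ge0// mulVf ?lexx// gt_eqF.
rewrite linearZ/= rnormZ rnorm_real_complex ger0_norm ?invr_ge0 ?rnorm_ge0//.
rewrite pmulr_rle0 ?invr_gt0// => fx0; apply: rnorm0_eq0.
by apply/eqP; rewrite eq_le fx0 rnorm_ge0.
Qed.

HB.instance Definition _ := Lmodule_isNormed.Build R[i] bounded_op normD normZ norm0_eq0.

End bounded_operators.

Definition dual (R : realType) (V : normedModType R[i]) : normedModType R[i] :=
  bounded_op V R[i]^o.

(* Unital C*-algebras. The product belongs to the mixin because the hierarchy
   has no join of rings and normed modules below [numDomainType]. *)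
HB.mixin Record isCStarAlgebra (R : realType) A
    & CompleteNormedModule R[i] A := {
  cunit : A ;
  cmul : A -> A -> A ;
  star : A -> A ;
  cmulA : associative cmul ;
  cmul1l : left_id cunit cmul ;
  cmul1r : right_id cunit cmul ;
  cmulPl : forall (c : R[i]) (x y z : A),
    cmul (c *: x + y) z = c *: cmul x z + cmul y z ;
  cmulPr : forall (c : R[i]) (x y z : A),
    cmul z (c *: x + y) = c *: cmul z x + cmul z y ;
  ler_norm_cmul : forall x y : A, `|cmul x y| <= `|x| * `|y| ;
  starK : involutive star ;
  starM : forall x y : A, star (cmul x y) = cmul (star y) (star x) ;
  starP : forall (c : R[i]) (x y : A), star (c *: x + y) = conjc c *: star x + star y ;
  cstar_identity : forall x : A, `|cmul (star x) x| = `|x| ^+ 2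
}.

#[short(type="cstarAlgType")]
HB.structure Definition CStarAlgebra (R : realType) :=
  {A of CompleteNormedModule R[i] A & isCStarAlgebra R A}.

Notation "x ** y" := (cmul x y) (at level 40, left associativity) : ring_scope.

(* The inner product is linear in its second argument. *)
HB.mixin Record isHilbert (R : realType) H & CompleteNormedModule R[i] H := {
  inner : H -> H -> R[i] ;
  innerP : forall (h : H) (c : R[i]) (k l : H),
    inner h (c *: k + l) = c * inner h k + inner h l ;
  innerC : forall h k : H, inner h k = conjc (inner k h) ;
  inner_norm : forall h : H, inner h h = `|h| ^+ 2
}.

#[short(type="hilbertType")]
HB.structure Definition Hilbert (R : realType) :=
  {H of CompleteNormedModule R[i] H & isHilbert R H}.

Section completely_positive.
Context {R : realType} (A : cstarAlgType R) (H : hilbertType R).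

(* Positivity in the C*-algebra of square matrices over [A]: Y = Z^* Z. *)
Definition mx_pos n (Y : 'M[A]_n) : Prop :=
  exists Z : 'M[A]_n, Y = \matrix_(i, j) \sum_(k < n) star (Z k i) ** Z k j.

(* A matrix of bounded operators of [H] acts on [H^n]; it is positive if it is
   positive as an operator of that Hilbert space. *)
Definition opmx_pos n (T : 'M[bounded_op H H]_n) : Prop :=
  forall h : 'I_n -> H, 0 <= \sum_(i < n) \sum_(j < n) inner (h i) (T i j (h j)).

Definition completely_positive (Phi : A -> bounded_op H H) : Prop :=
  forall n (Y : 'M[A]_n), mx_pos Y -> opmx_pos (map_mx Phi Y).

Record cp_map := CPMap {
  cp_fun :> {linear A -> bounded_op H H} ;
  cp_mapP : completely_positive cp_fun }.

End completely_positive.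

Section geometric_cauchy.
Context {R : realType} {V : completeNormedModType R[i]}.

Lemma geometric_cvg (u : nat -> V) :
  (forall n, rnorm (u n.+1 - u n) <= 2^-1 ^+ n) ->
  exists l : V, forall e : R, 0 < e ->
    exists N, forall n, (N <= n)%N -> rnorm (l - u n) < e.
Proof.
move=> ug.
have u1 n m : rnorm (u n - u (n + m)%N) <= 2 * 2^-1 ^+ n - 2 * 2^-1 ^+ (n + m)%N.
  elim: m => [|m IH]; first by rewrite addn0 !subrr rnorm0.
  apply: le_trans (ler_rdistD (u (n + m)%N) _ _) _.
  rewrite [X in _ + X]rnorm_distC addnS.
  have := ug (n + m)%N; rewrite exprS; lra.
have u2 N n m : (N <= n)%N -> (N <= m)%N -> rnorm (u n - u m) <= 4 * 2^-1 ^+ N.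
  move=> Nn Nm; apply: le_trans (ler_rdistD (u N) _ _) _.
  have := u1 N (n - N)%N; have := u1 N (m - N)%N.
  rewrite !subnKC// [X in _ -> _ -> X + _ <= _]rnorm_distC.
  have : 0 <= (2^-1 : R) ^+ n by rewrite exprn_ge0// invr_ge0.
  have : 0 <= (2^-1 : R) ^+ m by rewrite exprn_ge0// invr_ge0.
  lra.
have small (e : R) : 0 < e -> exists N, 4 * (2^-1 : R) ^+ N < e.
  move=> e0; have : (fun n => (2^-1 : R) ^+ n) @ \oo --> (0 : R).
    by apply: cvg_expr; rewrite ger0_norm ?invr_ge0// invf_lt1// ltr1n.
  move=> /cvgrPdist_lt /(_ (e / 4)) []; first by rewrite divr_gt0.
  move=> N _ /(_ N (leqnn _)) /=; rewrite sub0r normrN ger0_norm; last first.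
    by rewrite exprn_ge0// invr_ge0.
  by move=> eN; exists N; lra.
have cu : cvg (u @ \oo).
  apply/cauchy_cvgP/cauchy_ballP => e e0; near_simpl.
  have : 0 < complex.Re e by rewrite -ltcR RRe_real// gtr0_real.
  move=> /small[N eN]; exists ([set n | N <= n], [set n | N <= n])%N.
    by split; exists N.
  move=> [n m] [/= Nn Nm]; rewrite -ball_normE /= -rnormE.
  rewrite -(RRe_real (gtr0_real e0)) ltcR.
  exact: le_lt_trans (u2 _ _ _ Nn Nm) eN.
exists (lim (u @ \oo)) => e e0.
move/cvgrPdist_lt : (cu) => /(_ e%:C); rewrite ltcR => /(_ e0)[N _ uN].
by exists N => n Nn; rewrite -ltcR rnormE; exact: uN.
Qed.

End geometric_cauchy.

Section cstar_theory.
Context {R : realType} {A : cstarAlgType R}.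
Implicit Types x y z : A.

Lemma cmulDl x y z : (x + y) ** z = x ** z + y ** z.
Proof. by have := cmulPl 1 x y z; rewrite !scale1r. Qed.

Lemma cmulDr x y z : z ** (x + y) = z ** x + z ** y.
Proof. by have := cmulPr 1 x y z; rewrite !scale1r. Qed.

Lemma cmul0l z : 0 ** z = 0 :> A.
Proof. by apply: (addrI (0 ** z)); rewrite -cmulDl !addr0. Qed.

Lemma cmul0r z : z ** 0 = 0 :> A.
Proof. by apply: (addrI (z ** 0)); rewrite -cmulDr !addr0. Qed.

Lemma cmulZl (c : R[i]) x z : (c *: x) ** z = c *: (x ** z).
Proof. by have := cmulPl c x 0 z; rewrite cmul0l !addr0. Qed.

Lemma cmulZr (c : R[i]) x z : z ** (c *: x) = c *: (z ** x).
Proof. by have := cmulPr c x 0 z; rewrite cmul0r !addr0. Qed.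

Lemma cmulNl x z : (- x) ** z = - (x ** z).
Proof. by rewrite -[- x]scaleN1r cmulZl scaleN1r. Qed.

Lemma cmulNr x z : z ** (- x) = - (z ** x).
Proof. by rewrite -[- x]scaleN1r cmulZr scaleN1r. Qed.

Lemma starD x y : star (x + y) = star x + star y.
Proof. by have := starP 1 x y; rewrite conjc1 !scale1r. Qed.

Lemma star0 : star 0 = 0 :> A.
Proof. by apply: (addrI (star 0)); rewrite -starD !addr0. Qed.

Lemma starZ (c : R[i]) x : star (c *: x) = conjc c *: star x.
Proof. by have := starP c x 0; rewrite star0 !addr0. Qed.

Lemma starN x : star (- x) = - star x.
Proof. by apply/eqP; rewrite -addr_eq0 -starD addNr star0. Qed.

Lemma star1 : star (cunit : A) = cunit.
Proof. by rewrite -[LHS]cmul1l -{1}[cunit]starK -starM cmul1l starK. Qed.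

Lemma ler_rnorm_cmul x y : rnorm (x ** y) <= rnorm x * rnorm y.
Proof. by rewrite -lecR rmorphM/= !rnormE ler_norm_cmul. Qed.

Let rnorm_star_le x : rnorm x <= rnorm (star x).
Proof.
have [->|x0] := eqVneq x 0; first by rewrite rnorm0 rnorm_ge0.
have rx0 : 0 < rnorm x by rewrite -ltcR rnormE normr_gt0.
rewrite -(ler_pM2r rx0) -expr2.
suff -> : rnorm x ^+ 2 = rnorm (star x ** x) by exact: ler_rnorm_cmul.
by apply: complexI; rewrite rmorphXn/= !rnormE cstar_identity.
Qed.

Lemma rnorm_star x : rnorm (star x) = rnorm x.
Proof. by apply/eqP; rewrite eq_le rnorm_star_le andbT -{2}[x]starK rnorm_star_le. Qed.

(* A self-adjoint [x] of small norm is of the form [2 z - z^2], so that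
   [1 - x = (1 - z)^2] is positive. *)
Lemma selfadjoint_sub_square x : star x = x -> rnorm x <= 4^-1 ->
  exists y, cunit - x = star y ** y.
Proof.
move=> sx x4; pose F z := (2^-1)%:C *: (x + z ** z) : A.
pose u n := iter n F 0.
have FE z w : F z - F w = (2^-1)%:C *: (z ** (z - w) + (z - w) ** w).
  rewrite -scalerBr; congr (_ *: _).
  by rewrite cmulDr cmulDl cmulNl cmulNr addrA subrK opprD addrACA subrr add0r.
have rnorm2 z : rnorm ((2^-1)%:C *: z) = 2^-1 * rnorm z.
  by rewrite rnormZ rnorm_real_complex ger0_norm// invr_ge0.
have u4 n : rnorm (u n) <= 4^-1.
  elim: n => [|n IH]; first by rewrite rnorm0 invr_ge0.
  rewrite [u _]/(F (u n)) rnorm2.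
  have := ler_rnormD x (u n ** u n).
  have := ler_rnorm_cmul (u n) (u n); have := rnorm_ge0 (u n); nra.
have us n : star (u n) = u n.
  elim: n => [|n IH]; first by rewrite star0.
  by rewrite [u _]/(F (u n)) starZ conjc_real starD starM IH sx.
have uF n z : rnorm (u n.+1 - F z) <= 2^-1 * (rnorm (u n) + rnorm z) * rnorm (u n - z).
  rewrite [u _]/(F (u n)) FE rnorm2 -mulrA ler_wpM2l ?invr_ge0//.
  apply: le_trans (ler_rnormD _ _) _.
  rewrite mulrDl lerD ?ler_rnorm_cmul//.
  by rewrite mulrC ler_rnorm_cmul.
have [n|z zu] := @geometric_cvg _ A u.
  elim: n => [|n IH].
    rewrite expr0 /u /= subr0 /F cmul0l addr0 rnorm2; lra.
  apply: le_trans (uF _ _) _; rewrite exprS.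
  have := rnorm_ge0 (u n.+1 - u n); have := u4 n; have := u4 n.+1.
  nra.
have z1 : rnorm z <= 1.
  have [|N /(_ N (leqnn _)) zN] := zu 4^-1; first by rewrite invr_gt0.
  have := ler_rnormD (z - u N) (u N); rewrite subrK; have := u4 N; lra.
have zE : z = F z.
  apply/eqP; rewrite -subr_eq0; apply/eqP/rnorm0_eq0/eqP.
  rewrite eq_le rnorm_ge0 andbT leNgt; apply/negP => e0.
  have [|N zN] := zu (rnorm (z - F z) / 3); first by rewrite divr_gt0.
  have := zN N.+1 (leqnSn _); have := zN N (leqnn _).
  rewrite [X in X < _]rnorm_distC => zN0 zN1.
  have := ler_rdistD (u N.+1) z (F z); have := uF N z.
  have := u4 N; have := rnorm_ge0 (u N - z); have := rnorm_ge0 (u N).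
  have := rnorm_ge0 z; nra.
have zs : star z = z.
  apply/eqP; rewrite -subr_eq0; apply/eqP/rnorm0_eq0/eqP.
  rewrite eq_le rnorm_ge0 andbT leNgt; apply/negP => e0.
  have [|N /(_ N (leqnn _)) zN] := zu (rnorm (star z - z) / 3).
    by rewrite divr_gt0.
  have := ler_rdistD (u N) (star z) z; rewrite [rnorm (u N - z)]rnorm_distC.
  by rewrite -{1}(us N) -starN -starD rnorm_star; lra.
exists (cunit - z); rewrite starD starN star1 zs.
rewrite cmulDl !cmulDr !cmulNl !cmulNr cmul1l cmul1r cmul1l opprK.
have -> : x = (2%:C) *: z - z ** z.
  rewrite {1}zE /F scalerA -rmorphM/= mulfV// scale1r addrK//.
rewrite (_ : 2%:C = 1 + 1) ?rmorphD// scalerDl scale1r.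
by rewrite !opprD opprK !addrA.
Qed.

Lemma positive_functional_bounded (rho : {linear A -> R[i]^o}) :
  (forall y, 0 <= rho (star y ** y)) -> continuous rho.
Proof.
move=> rho0; apply/linear_bounded_continuous/ex_bound.
have rho1 : 0 <= rho cunit by have := rho0 cunit; rewrite star1 cmul1l.
have rhosa x : star x = x -> rnorm x <= 4^-1 -> `|rho x| <= rho cunit.
  move=> sx x4; have [y yE] := selfadjoint_sub_square sx x4.
  have [w wE] : exists w, cunit - (- x) = star w ** w.
    by apply: selfadjoint_sub_square; rewrite ?starN ?sx// rnormN.
  have := rho0 y; have := rho0 w; rewrite -yE -wE opprK linearB linearD/=.
  rewrite subr_ge0 -[rho x]opprK subr_ge0 opprK => xl xr.
  have xreal : rho x \is Num.real.
    by rewrite (ler_real xr) ger0_real.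
  by rewrite real_ler_norml// xr andbT lerNl.
exists (rho cunit *+ 2); apply/nbhs_normP => /=; exists (4^-1)%:C => /=.
  by rewrite ltcR invr_gt0.
move=> x /=; rewrite sub0r normrN -rnormE ltcR => /ltW x4.
have half2 (y : A) : rnorm ((2^-1)%:C *: y) = 2^-1 * rnorm y.
  by rewrite rnormZ rnorm_real_complex ger0_norm// invr_ge0.
have ri : rnorm ('i : R[i]^o) = 1.
  by rewrite /rnorm normc_def/= expr0n expr1n add0r sqrtr1.
pose b := (2^-1)%:C *: (x + star x); pose c := - 'i *: ((2^-1)%:C *: (x - star x)).
have -> : x = b + 'i *: c.
  rewrite /b /c scalerA mulrN -expr2 sqr_i opprK scale1r -scalerDr.
  rewrite addrACA subrr addr0 -mulr2n -(@scaler_nat R[i] _ 2 x) scalerA.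
  by rewrite -(rmorph_nat (real_complex R)) -rmorphM/= mulVf// scale1r.
have -> : rho (b + 'i *: c) = rho b + 'i * rho c by rewrite linearD [rho ('i *: c)]linearZ.
rewrite (le_trans (ler_normD _ _))// normrM mulr2n lerD//.
  apply: rhosa; first by rewrite /b starZ conjc_real starD starK addrC.
  rewrite half2; have := ler_rnormD x (star x); rewrite rnorm_star; lra.
rewrite -(@rnormE _ R[i]^o 'i) ri mul1r; apply: rhosa.
  rewrite /c !starZ conjc_real starD starN starK.
  have -> : conjc (- 'i) = 'i :> R[i] by rewrite /= !oppr0 !opprK.
  by rewrite -[star x - x]opprB 2![_ *: - _]scalerN scaleNr.
rewrite rnormZ half2 rnormN ri mul1r.
have := ler_rnormD x (- star x); rewrite rnormN rnorm_star; lra.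
Qed.

End cstar_theory.

Section matrix_coefficient.
Context {R : realType} {A : cstarAlgType R} {H : hilbertType R}.
Implicit Types (Phi : cp_map A H) (h k l : H).

Lemma innerDr h k l : inner h (k + l) = inner h k + inner h l.
Proof. by have := innerP h 1 k l; rewrite scale1r mul1r. Qed.

Lemma inner0r h : inner h 0 = 0.
Proof. by apply: (addrI (inner h 0)); rewrite -innerDr !addr0. Qed.

Lemma innerZr h (c : R[i]) k : inner h (c *: k) = c * inner h k.
Proof. by have := innerP h c k 0; rewrite inner0r !addr0. Qed.

Lemma innerDl h k l : inner (h + k) l = inner h l + inner k l.
Proof. by rewrite innerC innerDr rmorphD/= -!innerC. Qed.

Lemma innerZl h (c : R[i]) k : inner (c *: h) k = conjc c * inner h k.
Proof. by rewrite innerC innerZr rmorphM/= -innerC. Qed.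

Definition coef_fun Phi h k : A -> R[i]^o := fun a => inner h (Phi a k).

Lemma coef_fun_linear Phi h k : linear (coef_fun Phi h k).
Proof.
move=> c a b; rewrite /coef_fun linearP.
by rewrite [X in inner h X](_ : _ = c *: Phi a k + Phi b k)// innerP.
Qed.

HB.instance Definition _ Phi h k :=
  GRing.isLinear.Build R[i] A R[i]^o _ (coef_fun Phi h k)
    (@coef_fun_linear Phi h k).

Lemma coef_fun_continuous_diag Phi h : continuous (coef_fun Phi h h).
Proof.
apply: positive_functional_bounded => y; rewrite /= /coef_fun.
pose Y : 'M[A]_1 := const_mx (star y ** y).
have Ypos : mx_pos Y.
  by exists (const_mx y); apply/matrixP => i j; rewrite !mxE big_ord1 !mxE.
by have := cp_mapP Phi Ypos (fun=> h); rewrite !big_ord1 !mxE.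
Qed.

Lemma coef_fun_polar Phi h k a : coef_fun Phi h k a = 2^-1 *
  ((coef_fun Phi (h + k) (h + k) a - coef_fun Phi h h a - coef_fun Phi k k a)
   - 'i * (coef_fun Phi (h + 'i *: k) (h + 'i *: k) a
           - coef_fun Phi h h a - coef_fun Phi k k a)).
Proof.
rewrite /coef_fun !linearD !linearZ/= !(innerDl, innerDr) !(innerZl, innerZr).
have i2 : 'i * 'i = -1 :> R[i] by rewrite -expr2 sqr_i.
have -> : conjc 'i = - 'i :> R[i] by apply/eqP; rewrite eq_complex /= oppr0 !eqxx.
set p := inner h _; set q := inner h _; set r := inner k _; set s := inner k _.
rewrite [X in _ * X](_ : _ = 2 * p) ?mulKf//.
rewrite -[_ *: _]/('i * _).
by ring: i2.
Qed.

(* Automatic continuity of completely positive maps makes [a |-> <h, Phi(a) k>]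
   an element of the dual of [A]. *)
Lemma coef_fun_bounded Phi h k : coef_fun Phi h k \in @bounded_op_pred R A R[i]^o.
Proof.
apply/asboolP; split; first exact: coef_fun_linear.
have cD h' := @coef_fun_continuous_diag Phi h'.
rewrite (_ : coef_fun Phi h k = fun a : A => (2^-1 : R[i]) *:
  ((coef_fun Phi (h + k) (h + k) a - coef_fun Phi h h a - coef_fun Phi k k a)
   - 'i *: (coef_fun Phi (h + 'i *: k) (h + 'i *: k) a
           - coef_fun Phi h h a - coef_fun Phi k k a))); last first.
  by apply/funext => a; exact: coef_fun_polar.
move=> a; apply: cvgZr; apply: cvgB.
  by apply: cvgB; [apply: cvgB|]; exact: cD.
by apply: cvgZr; apply: cvgB; [apply: cvgB|]; exact: cD.
Qed.

Definition coefficient Phi h k : dual A := BoundedOp (coef_fun_bounded Phi h k).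

Lemma coefficientE Phi h k a : coefficient Phi h k a = inner h (Phi a k).
Proof. by []. Qed.

End matrix_coefficient.

Section vector_measures.
Context {R : realType} {d : measure_display} {X : measurableType d}.

Definition complex_measure (m : set X -> R[i]) : Prop :=
  forall F : nat -> set X, (forall n, measurable (F n)) -> trivIset setT F ->
    (fun n => \sum_(i < n) m (F i) : R[i]^o) @ \oo -->
      (m (\bigcup_n F n) : R[i]^o).

Definition measurable_partition (E : set X) n (F : 'I_n -> set X) : Prop :=
  [/\ forall i, measurable (F i), trivIset setT F & \bigcup_i F i = E].

Definition semivariation (B : normedModType R[i]) (mu : set X -> B)
    (E : set X) : \bar R :=
  ereal_sup [set s | exists n (F : 'I_n -> set X) (phi : dual B),
    [/\ measurable_partition E F, `|phi| <= 1 &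
        s = (\sum_(i < n) rnorm (phi (mu (F i))))%:E]].

Definition semivariation_ae (B : normedModType R[i]) (mu : set X -> B)
    (P : X -> Prop) : Prop :=
  exists N : set X, [/\ measurable N, semivariation mu N = 0%E &
    forall x, ~ N x -> P x].

Definition simple_function (B : normedModType R[i]) (f : X -> B) : Prop :=
  exists n (b : 'I_n -> B) (F : 'I_n -> set X),
    (forall i, measurable (F i)) /\
    f = fun x => \sum_(i < n) (\1_(F i) x : R[i]) *: b i.

End vector_measures.

Definition separable_set (T : topologicalType) (S : set T) : Prop :=
  exists D : set T, [/\ countable D, D `<=` S & S `<=` closure D].

Section instruments.
Context {R : realType} {d : measure_display} {X : measurableType d}.
Context {A : cstarAlgType R} {H : hilbertType R}.

(* As for the measures of the library, an instrument is a function on all sets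
   whose values on nonmeasurable sets are irrelevant. *)
Definition cp_instrument (I : set X -> cp_map A H) : Prop :=
  forall (h k : H) (a : A), complex_measure (fun E => inner h (I E a k)).

Definition instrument_coef (I : set X -> cp_map A H) (h k : H) :
    set X -> dual A :=
  fun E => coefficient (I E) h k.

Definition strongly_measurable (I : set X -> cp_map A H)
    (B : normedModType R[i]) (f : X -> B) : Prop :=
  forall h k : H, exists g : nat -> X -> B,
    (forall n, simple_function (g n)) /\
    semivariation_ae (instrument_coef I h k)
      (fun x => (`|g n x - f x| : R[i]^o) @[n --> \oo] --> (0 : R[i]^o)).

Definition weakly_measurable (I : set X -> cp_map A H) (f : X -> A) : Prop :=
  forall phi : dual A, strongly_measurable I (fun x => phi (f x) : R[i]^o).

Definition essentially_separably_valued (I : set X -> cp_map A H)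
    (f : X -> A) : Prop :=
  forall h k : H, exists E : set X,
    [/\ measurable E, semivariation (instrument_coef I h k) E = 0%E &
        separable_set (f @` (~` E))].

End instruments.

(* Main.v *)
Require Import Defs.
From HB Require Import structures.
From mathcomp Require Import all_boot all_order all_algebra.
From mathcomp Require Import complex.
From mathcomp Require Import all_classical all_reals all_analysis.
From mathcomp Require Import measurable_realfun.
From mathcomp Require Import ring lra.

(** This is Pettis' measurability theorem, with the null sets of all the
    vector measures [instrument_coef I h k] in the role of the null sets of a
    measure. Everything is done for fixed [h] and [k].

    What makes the classical argument available is that the null sets form a
    sigma-ideal: a measurable set is null for the semivariation exactly when
    the vector measure vanishes on all its measurable subsets
    ([semivariation_eq0]), and countable additivity of the instrument carries
    this property to countable unions ([semivariation_bigcup_eq0]).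

    If [f] is a limit of simple functions off a null set, then its values there
    are limits of points of a countable set, namely of all values of the
    approximations; a subset of the closure of a countable set of a normed
    space is separable ([separable_sub_closure]). Composing the approximations
    with a functional gives weak measurability.

    Conversely, let [u] be a sequence the closure of whose range contains the
    values of [f] off a null set. By Hahn-Banach ([norming_functional]) there
    are functionals [phi j m] of norm at most one that norm [u m - u j]; by
    density, the distance from [f x] to [u j] is the supremum over [m] of the absolute
    values of [phi j m (f x - u j)] ([rnorm_eq_sup]). Each of these countably
    many scalar functions is a limit of simple functions off a null set, so
    off one null set, the union of all of them, every distance function
    [x |-> |f x - u j|] is measurable ([measurable_rnorm_sub]). Replacing [f x]
    by a nearest point among [u 0, ..., u (n - 1)] then gives functions that are
    simple, because they are chosen by comparing measurable functions, and that
    converge to [f], because some [u m] is as close to [f x] as desired.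

    Hahn-Banach is proved for the real part first. A minimal element among the
    sublinear functions is additive, and minimal elements below any given
    sublinear function exist by Zorn's lemma. This avoids extending partially
    defined functionals. *)

Set Implicit Arguments.
Unset Strict Implicit.
Unset Printing Implicit Defensive.
Import Order.TTheory GRing.Theory Num.Theory.
Import numFieldNormedType.Exports.
Local Open Scope classical_set_scope.
Local Open Scope ring_scope.
Local Open Scope complex_scope.

(** * Norming functionals *)

Section norming_functional.
Context {R : realType} {V : normedModType R[i]}.
Implicit Types (p q : V -> R) (x y : V).

(** Homogeneity is only asked for as an inequality, which is the part that
    passes to infima; the equality is recovered in [sublinearZ]. Scalars are real:
    the complex structure enters only in [norming_functional]. *)
Definition sublinear q : Prop :=
  (forall x y, q (x + y) <= q x + q y) /\
  (forall (t : R) x, 0 <= t -> q (t%:C *: x) <= t * q x).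

Lemma sublinear_rnorm : sublinear (@rnorm R V).
Proof.
split; first exact: ler_rnormD.
by move=> t x t0; rewrite rnormZ rnorm_real_complex ger0_norm.
Qed.

Lemma sublinear0 q : sublinear q -> q 0 = 0.
Proof.
case=> qD qZ; have := qZ 0 0 (lexx _); have := qD 0 0.
rewrite addr0 scaler0; lra.
Qed.

Lemma sublinear_ge q x : sublinear q -> - q (- x) <= q x.
Proof.
by move=> sq; have := sq.1 x (- x); rewrite subrr sublinear0//; lra.
Qed.

Lemma sublinearZ q (t : R) x : sublinear q -> 0 <= t -> q (t%:C *: x) = t * q x.
Proof.
move=> sq; rewrite le_eqVlt => /predU1P[<-|t0].
  by rewrite scale0r mul0r sublinear0.
apply/eqP; rewrite eq_le (sq.2 _ _ (ltW t0))/= -ler_pdivlMl//.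
have := sq.2 t^-1 (t%:C *: x); rewrite scalerA -rmorphM/= mulVf ?gt_eqF//.
by rewrite scale1r; apply; rewrite invr_ge0 ltW.
Qed.

(** The largest sublinear function below [q] whose value at [- y] is at most
    [- q y]. It serves twice: to reach a function that attains the norm of a
    given vector, and to show that a minimal [q] is odd. *)
Definition slope_inf q y x : R :=
  inf [set q (x + t%:C *: y) - t * q y | t in [set t : R | 0 <= t]].

Section slope_inf_theory.
Variables (q : V -> R) (y : V).
Hypothesis sq : sublinear q.

Lemma slope_inf_le x (t : R) :
  0 <= t -> slope_inf q y x <= q (x + t%:C *: y) - t * q y.
Proof.
move=> t0; apply: ge_inf; last by exists t.
exists (- q (- x)) => _ [s /= s0 <-]; rewrite -sublinearZ//.
by have := sq.1 (x + s%:C *: y) (- x); rewrite addrAC subrr add0r; lra.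
Qed.

Lemma slope_inf_ge x (c : R) :
  (forall t : R, 0 <= t -> c <= q (x + t%:C *: y) - t * q y) ->
  c <= slope_inf q y x.
Proof.
move=> cq; apply: lb_le_inf; first by exists (q (x + 0%:C *: y) - 0 * q y), 0 => /=.
by move=> _ [t /= t0 <-]; exact: cq.
Qed.

Lemma slope_inf_le_id x : slope_inf q y x <= q x.
Proof. by have := slope_inf_le x (lexx 0); rewrite scale0r addr0 mul0r subr0. Qed.

Lemma slope_inf_oppr : slope_inf q y (- y) <= - q y.
Proof.
have := slope_inf_le (- y) ler01.
by rewrite scale1r addNr sublinear0// mul1r sub0r.
Qed.

Lemma sublinear_slope_inf : sublinear (slope_inf q y).
Proof.
split=> [x z|c x c0].
  rewrite -lerBlDr; apply: slope_inf_ge => s s0.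
  rewrite lerBlDr -lerBlDl; apply: slope_inf_ge => t t0.
  have := slope_inf_le (x + z) (addr_ge0 s0 t0).
  have := sq.1 (x + s%:C *: y) (z + t%:C *: y).
  rewrite addrACA -scalerDl -rmorphD/=; lra.
move: c0; rewrite le_eqVlt => /predU1P[<-|c0].
  by rewrite scale0r mul0r (le_trans (slope_inf_le_id 0))// sublinear0.
rewrite -ler_pdivrMl//; apply: slope_inf_ge => t t0.
rewrite ler_pdivrMl// mulrBr -(sublinearZ (x + _) sq (ltW c0)) scalerDr scalerA -rmorphM/=.
by rewrite mulrA; apply: slope_inf_le; rewrite mulr_ge0// ltW.
Qed.

End slope_inf_theory.

(** Zorn's lemma applies because the pointwise infimum of a chain is again
    sublinear; it is finite since all functions below [p] lie above
    [x |-> - p (- x)]. *)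
Lemma exists_minimal_sublinear p : sublinear p ->
  exists q, [/\ sublinear q, forall x, q x <= p x &
    forall r, sublinear r -> (forall x, r x <= q x) -> r = q].
Proof.
move=> sp; pose T := {q : V -> R | sublinear q /\ forall x, q x <= p x}.
pose below (a b : T) := `[< forall x, sval b x <= sval a x >].
have Tge (a : T) x : - p (- x) <= sval a x.
  case: a => q [sq qp] /=; apply: le_trans (sublinear_ge x sq).
  by rewrite lerN2.
have p0 : T by exists p.
have [a|a b c /asboolP ab /asboolP bc|C Ctot|m mmin] := @ZL_preorder T p0 below.
- exact/asboolP.
- by apply/asboolP => x; exact: le_trans (bc x) (ab x).
- have [[c0 Cc0]|C0] := pselect (exists c, C c); last first.
    by exists p0 => s Cs; exfalso; apply: C0; exists s.
  pose u x := inf [set sval c x | c in C].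
  have ule c x : C c -> u x <= sval c x.
    move=> Cc; apply: ge_inf; last by exists c.
    by exists (- p (- x)) => _ [a _ <-]; exact: Tge.
  have uge r x : (forall c, C c -> r <= sval c x) -> r <= u x.
    move=> ru; apply: lb_le_inf; first by exists (sval c0 x), c0.
    by move=> _ [c Cc <-]; exact: ru.
  have su : sublinear u.
    split=> [x y|t x t0].
      (* Of two members of the chain, the smaller one bounds both infima. *)
      rewrite -lerBlDr; apply: (uge) => a Ca.
      rewrite lerBlDr -lerBlDl; apply: (uge) => b Cb.
      rewrite lerBlDl.
      have [ab|ba] := Ctot _ _ Ca Cb.
        apply: le_trans (ule b _ Cb) _; apply: le_trans ((svalP b).1.1 _ _) _.
        by rewrite lerD2r; move/asboolP : ab; exact.
      apply: le_trans (ule a _ Ca) _; apply: le_trans ((svalP a).1.1 _ _) _.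
      by rewrite lerD2l; move/asboolP : ba; exact.
    move: t0; rewrite le_eqVlt => /predU1P[<-|t0].
      rewrite scale0r mul0r; apply: le_trans (ule _ _ Cc0) _.
      by rewrite sublinear0//; exact: (svalP c0).1.
    rewrite -ler_pdivrMl//; apply: (uge) => c Cc; rewrite ler_pdivrMl//.
    by apply: le_trans (ule _ _ Cc) _; apply: (svalP c).1.2; exact: ltW.
  have up x : u x <= p x by apply: le_trans (ule _ _ Cc0) _; exact: (svalP c0).2.
  by exists (exist _ u (conj su up)) => s Cs; apply/asboolP => x; exact: ule.
exists (sval m); split; [exact: (svalP m).1|exact: (svalP m).2|].
move=> r sr rm; apply/funext => x; apply/eqP; rewrite eq_le rm/=.
have rp z : r z <= p z by apply: le_trans (rm z) _; exact: (svalP m).2.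
have /asboolP/(_ x) := mmin (exist _ r (conj sr rp)) (introT (asboolP _) rm).
by [].
Qed.

(** By minimality [q] coincides with [slope_inf q x], whose value at [- x] is
    at most [- q x]. *)
Lemma minimal_sublinearN q : sublinear q ->
  (forall r, sublinear r -> (forall x, r x <= q x) -> r = q) ->
  forall x, q (- x) = - q x.
Proof.
move=> sq qmin x; apply/eqP; rewrite eq_le; apply/andP; split.
  have qE := qmin _ (sublinear_slope_inf x sq) (slope_inf_le_id x sq).
  by rewrite -[X in X _ <= _]qE slope_inf_oppr.
by have := sublinear_ge (- x) sq; rewrite opprK.
Qed.

Lemma minimal_sublinearD q : sublinear q ->
  (forall r, sublinear r -> (forall x, r x <= q x) -> r = q) ->
  forall x y, q (x + y) = q x + q y.
Proof.
move=> sq qmin x y; have qN := minimal_sublinearN sq qmin.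
apply/eqP; rewrite eq_le sq.1/=.
by have := sq.1 (- x) (- y); rewrite -opprD !qN; lra.
Qed.

(** The form of the Hahn-Banach theorem that is used here. The real part [q] of
    [phi] is a minimal sublinear function below [slope_inf rnorm x0]; this
    bound forces [q x0 = |x0|]. *)
Lemma norming_functional x0 :
  exists phi : dual V, (forall x, rnorm (phi x : R[i]^o) <= rnorm x) /\
    rnorm (phi x0 : R[i]^o) = rnorm x0.
Proof.
have [q [sq qle qmin]] :=
  exists_minimal_sublinear (sublinear_slope_inf x0 sublinear_rnorm).
have qD := minimal_sublinearD sq qmin.
have qN := minimal_sublinearN sq qmin.
have qnorm x : q x <= rnorm x.
  by apply: le_trans (qle x) _; exact: slope_inf_le_id sublinear_rnorm _.
have q_x0 : rnorm x0 <= q x0.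
  rewrite -lerN2 -qN; apply: le_trans (qle _) _.
  exact: slope_inf_oppr sublinear_rnorm.
have qZ (t : R) x : q (t%:C *: x) = t * q x.
  have [t0|t0] := leP 0 t; first exact: sublinearZ.
  rewrite -[t]opprK rmorphN/= scaleNr qN sublinearZ ?mulNr//.
  by rewrite oppr_ge0 ltW.
(* A complex functional is determined by its real part: the imaginary part of
   [phi x] is minus the real part of [phi (i x)]. *)
pose phi x : R[i]^o := (q x +i* - q ('i *: x)).
have phiZ (c : R[i]) x : phi (c *: x) = c * phi x.
  case: c => a b; have -> : a +i* b = a%:C + 'i * b%:C.
    by rewrite [LHS]complexE.
  rewrite /phi scalerA mulrDr mulrA -expr2 sqr_i mulN1r !scalerDl qD qD.
  rewrite scaleNr qN [_ * a%:C]mulrC [_ * b%:C]mulrC -!scalerA !qZ.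
  apply/eqP; rewrite eq_complex /=; apply/andP; split; apply/eqP; ring.
have phiD x y : phi (x + y) = phi x + phi y.
  apply/eqP; rewrite /phi scalerDr !qD eq_complex /= eqxx/=; apply/eqP; ring.
have phil : linear phi by move=> c x y; rewrite phiD phiZ.
have phib x : rnorm (phi x) <= rnorm x.
  have [z0|z0] := eqVneq (phi x) 0; first by rewrite z0 rnorm0 rnorm_ge0.
  have rz0 : 0 < rnorm (phi x) by rewrite -ltcR rnormE normr_gt0.
  (* Multiplying [x] by the conjugate of [phi x] makes [phi] real there, so that
     the bound on [q] applies. *)
  rewrite -(ler_pM2l rz0).
  have <- : rnorm ((phi x)^*%C *: x) = rnorm (phi x) * rnorm x.
    by rewrite rnormZ; congr (_ * _); rewrite /rnorm !normc_def /= sqrrN.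
  apply: le_trans (qnorm _).
  have -> : q ((phi x)^*%C *: x) = complex.Re (phi ((phi x)^*%C *: x)) by [].
  rewrite phiZ /rnorm normc_def -expr2 [complex.Re _%:C]/= sqr_sqrtr; last first.
    by rewrite addr_ge0 ?sqr_ge0.
  by rewrite /= mulNr opprK !expr2.
have phic : phi \in @bounded_op_pred R V R[i]^o.
  apply/asboolP; split=> //.
  pose Phi : {linear V -> R[i]^o} :=
    HB.pack phi (GRing.isLinear.Build R[i] V R[i]^o _ phi phil).
  apply: (linear_bounded_continuous Phi).1; apply/linear_boundedP.
  exists 1; split; first exact: real1.
  move=> M /ltW M1 x; rewrite -!rnormE (le_trans _ (ler_wpM2r _ M1))//.
    by rewrite mul1r lecR phib.
  by rewrite ler0c rnorm_ge0.
exists (BoundedOp phic); split => //=.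
apply/eqP; rewrite eq_le phib/=; apply: le_trans q_x0 _.
rewrite -lecR rnormE; apply: le_trans (normc_ge_Re _).
by rewrite lecR ler_norm.
Qed.

End norming_functional.

(** * Null sets of the semivariation *)

Lemma dual_norm_le1 (R : realType) (V : normedModType R[i]) (phi : dual V) :
  (forall x, rnorm (phi x : R[i]^o) <= rnorm x) -> `|phi| <= 1.
Proof.
move=> phi1; change ((opnorm phi)%:C <= 1); rewrite lecR.
by apply: opnorm_le => x x1; exact: le_trans (phi1 x) x1.
Qed.

Section null_sets.
Context {R : realType} {d : measure_display} {X : measurableType d}.

(** A value [mu F] with [F] inside [E] is detected by a norming functional and
    the partition of [E] into [F] and its complement. *)
Lemma semivariation_eq0 (B : normedModType R[i]) (mu : set X -> B) (E : set X) :
  measurable E -> semivariation mu E = 0%E <->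
  forall F, measurable F -> F `<=` E -> mu F = 0.
Proof.
move=> mE; split=> [E0 F mF FE|mu0].
  have [phi [phi1 phiF]] := norming_functional (mu F).
  apply: rnorm0_eq0; rewrite -phiF; apply/eqP; rewrite eq_le rnorm_ge0 andbT.
  pose G (i : 'I_2) := if i == 0 :> nat then F else E `\` F.
  have : ((\sum_(i < 2) rnorm (phi (mu (G i)) : R[i]^o))%:E <= semivariation mu E)%E.
    apply: ereal_sup_ubound; exists 2, G, phi; split => //; last exact: dual_norm_le1.
    split.
    - by move=> i; rewrite /G; case: ifP => // _; exact: measurableD.
    - apply/trivIsetP => -[[|[|//]] i2] [[|[|//]] j2] _ _ //= _; rewrite /G/=.
        by rewrite setDE setICA setICr setI0.
      by rewrite setDE -setIA setICl setI0.
    - apply/seteqP; split=> x.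
        by case=> i _; rewrite /G; case: ifP => _; [exact: FE|case].
      have [Fx _|nFx Ex] := pselect (F x); first by exists ord0.
      by exists ord_max.
  rewrite E0 lee_fin !big_ord_recl big_ord0 addr0 /=; apply: le_trans.
  by rewrite lerDl rnorm_ge0.
apply/eqP; rewrite eq_le; apply/andP; split.
  apply: ge_ereal_sup => _ [n [F [phi [[mF tF FE] _ ->]]]].
  rewrite big1 // => i _; rewrite mu0 ?linear0 ?rnorm0//.
  by rewrite -FE; exact: bigcup_sup.
apply: ereal_sup_ubound; exists 1, (fun=> E), 0; split.
- split => //; last by rewrite bigcup_const//; exists ord0.
  by apply/trivIsetP => i j; rewrite !ord1.
- by rewrite normr0 ler01.
- by rewrite mu0// big1// => i _; rewrite rnorm0.
Qed.

Context {A : cstarAlgType R} {H : hilbertType R} (I : set X -> cp_map A H).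

(** Only pointwise countable additivity is available, so the coefficient of a
    subset of the union is computed one [a] at a time, as the limit of a sum of
    zeros over a disjoint decomposition. *)
Lemma semivariation_bigcup_eq0 (h k : H) (N : nat -> set X) :
  cp_instrument I -> (forall n, measurable (N n)) ->
  (forall n, semivariation (instrument_coef I h k) (N n) = 0%E) ->
  semivariation (instrument_coef I h k) (\bigcup_n N n) = 0%E.
Proof.
move=> hI mN N0; apply/semivariation_eq0; first exact: bigcup_measurable.
move=> F mF FN; apply: val_inj; apply/funext => a /=.
have mG n : measurable (F `&` seqDU N n).
  by apply: measurableI => //; exact: seqDU_measurable.
have tG : trivIset setT (fun n => F `&` seqDU N n).
  exact/trivIset_setIl/trivIset_seqDU.
have := hI h k a _ mG tG.
rewrite -setI_bigcupr -seqDU_bigcup_eq (setIidl FN).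
rewrite (_ : (fun n => _) = fun=> 0 : R[i]^o); last first.
  apply/funext => n; rewrite big1// => i _.
  rewrite -[LHS]/(instrument_coef I h k (F `&` seqDU N i) a).
  have /semivariation_eq0 -> // := N0 i.
  exact: subset_trans (@subIsetr _ _ _) (@subset_seqDU _ _ _).
by move=> /(cvg_unique (@norm_hausdorff _ _)) /(_ (cvg_cst _)).
Qed.

End null_sets.

(** * Simple functions *)

Section simple_functions.
Context {R : realType} {d : measure_display} {X : measurableType d}.
Context {B : normedModType R[i]}.
Implicit Types (g : X -> B) (F : set X).

Lemma simple_function_cst (b : B) : simple_function (fun _ : X => b).
Proof.
exists 1, (fun=> b), (fun=> setT); split => // .
by apply/funext => x; rewrite big_ord1 indicT scale1r.
Qed.

Lemma simple_function_if F (b : B) g : measurable F -> simple_function g ->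
  simple_function (fun x => if x \in F then b else g x).
Proof.
move=> mF [n [c [G [mG ->]]]].
exists n.+1, (fun i => oapp c b (unlift ord0 i)),
  (fun i => oapp (fun j => G j `\` F) F (unlift ord0 i)); split.
  by move=> i; case: unliftP => [j _|_] //=; exact: measurableD.
apply/funext => x; rewrite big_ord_recl unlift_none [oapp c b None]/=.
under [X in _ = _ + X]eq_bigr => i _ do rewrite liftK [oapp _ _ (Some i)]/= indicE in_setD.
rewrite indicE [oapp _ _ _]/=.
case: (x \in F).
  by rewrite scale1r big1 ?addr0// => i _; rewrite andbF scale0r.
by rewrite scale0r add0r; apply: eq_bigr => i _; rewrite andbT indicE.
Qed.

Lemma simple_function_finite_range g : simple_function g -> finite_set (range g).
Proof.
case=> n [b [F [_ ->]]].
(* The value at [x] depends only on which of the sets contain [x]. *)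
pose val (S : {ffun 'I_n -> bool}) := \sum_(i < n) (S i)%:R *: b i : B.
apply: (@sub_finite_set _ _ (val @` setT)); last exact: finite_image.
move=> _ [x _ <-]; exists [ffun i => x \in F i] => //.
by apply: eq_bigr => i _; rewrite ffunE indicE.
Qed.

(** This makes any function of the values of [g] measurable, in particular the
    distances of these values to a point: [g] takes finitely many values, each on
    a measurable set. *)
Lemma measurable_simple_preimage g (P : set B) :
  simple_function g -> measurable (g @^-1` P).
Proof.
case=> n [b [F [mF ->]]]; elim: n => [|n IH] in b F mF P *.
  have [P0|P0] := pselect (P 0).
    rewrite (_ : _ @^-1` _ = setT)//; apply/seteqP; split=> x //=.
    by rewrite big_ord0.
  rewrite (_ : _ @^-1` _ = set0)//; apply/seteqP; split=> x //=.
  by rewrite big_ord0.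
pose s x : B := \sum_(i < n) (\1_(F (lift ord0 i)) x : R[i]) *: b (lift ord0 i).
have ms (Q : set B) : measurable (s @^-1` Q) by exact: IH.
rewrite (_ : _ @^-1` _ = (F ord0 `&` s @^-1` [set y | P (b ord0 + y)]) `|`
                         (s @^-1` P `\` F ord0)); last first.
  apply/seteqP; split => x /=; rewrite big_ord_recl indicE -/(s x).
    have [Fx|Fx] := boolP (x \in F ord0).
      by rewrite scale1r; left; split => //; exact/set_mem.
    by rewrite scale0r add0r => ?; right; split => // /mem_set; exact/negP.
  move=> [[Fx]|[Px Fx]]; first by rewrite (mem_set Fx) scale1r.
  by rewrite (memNset Fx) scale0r add0r.
by apply: measurableU; [apply: measurableI|apply: measurableD].
Qed.

End simple_functions.

Lemma simple_function_linear (R : realType) (d : measure_display)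
    (X : measurableType d) (U V : normedModType R[i]) (phi : bounded_op U V)
    (g : X -> U) : simple_function g -> simple_function (phi \o g).
Proof.
case=> n [b [F [mF ->]]]; exists n, (phi \o b), F; split => //.
by apply/funext => x /=; rewrite linear_sum; apply: eq_bigr => i _; rewrite linearZ.
Qed.

(** * Separability of subsets *)

Section separability.
Context {R : realType} {V : normedModType R[i]}.
Implicit Types (D S : set V) (x y : V).

Lemma closure_rnormP D x :
  closure D x <-> forall e : R, 0 < e -> exists2 y, D y & rnorm (x - y) < e.
Proof.
split=> [Dx e e0|De U /nbhs_normP[e /= e0 eU]].
  have [|y [Dy xy]] := Dx (ball x e%:C).
    by apply: nbhsx_ballx; rewrite ltcR.
  by exists y => //; move: xy; rewrite -ball_normE /= -ltcR rnormE.
have e0' : 0 < complex.Re e by rewrite -ltcR RRe_real// gtr0_real.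
have [y Dy xy] := De _ e0'; exists y; split => //; apply: eU => /=.
by rewrite -rnormE -(RRe_real (gtr0_real e0)) ltcR.
Qed.

Lemma cvg_norm0P (u : nat -> V) :
  (`|u n| : R[i]^o) @[n --> \oo] --> (0 : R[i]^o) <->
  (rnorm (u n) @[n --> \oo] --> (0 : R)).
Proof.
split=> [/cvgrPdist_lt u0|/cvgrPdist_lt u0]; apply/cvgrPdist_lt => e e0.
  have := u0 e%:C; rewrite ltcR => /(_ e0); apply: filterS => n.
  by rewrite !sub0r !normrN normr_id -rnormE ltcR ger0_norm// rnorm_ge0.
have e0' : 0 < complex.Re e by rewrite -ltcR RRe_real// gtr0_real.
have := u0 _ e0'; apply: filterS => n.
rewrite !sub0r !normrN normr_id ger0_norm ?rnorm_ge0// -rnormE.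
by rewrite -[in X in _ -> X](RRe_real (gtr0_real e0)) ltcR.
Qed.

Lemma exists_natSinv_lt (e : R) : 0 < e -> exists m : nat, m.+1%:R^-1 < e.
Proof.
by move=> e0; have [m _ /(_ m (leqnn m))] := near_infty_natSinv_lt (PosNum e0); exists m.
Qed.

(** The points of [D] need not lie in [S]. A countable dense subset of [S] is
    obtained by choosing, for each [y] in [D] and each [m], a point of [S] at
    distance less than [1 / (m + 1)] from [y], when there is one. *)
Lemma separable_sub_closure D S :
  countable D -> S `<=` closure D -> separable_set S.
Proof.
move=> cD SD.
have /choice[p pP] (z : V * nat) : exists s : V,
    (exists2 s, S s & rnorm (s - z.1) < z.2.+1%:R^-1) ->
    S s /\ rnorm (s - z.1) < z.2.+1%:R^-1.
  have [[s Ss sz]|nex] := pselect (exists2 s, S s & rnorm (s - z.1) < z.2.+1%:R^-1).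
    by exists s.
  by exists 0.
(* Where no point of [S] is close, [p] may take a value outside [S]. *)
exists (S `&` p @` (D `*` setT)); split; last 2 first.
- exact: subIsetl.
- move=> s Ss; apply/closure_rnormP => e e0.
  have [|m me] := @exists_natSinv_lt (e / 2); first by rewrite divr_gt0.
  have m0 : (0 : R) < m.+1%:R^-1 by rewrite invr_gt0.
  have [y Dy sy] := (closure_rnormP _ _).1 (SD _ Ss) _ m0.
  have [|Sp py] := pP (y, m); first by exists s.
  exists (p (y, m)); first by split => //; exists (y, m).
  apply: le_lt_trans (ler_rdistD y _ _) _.
  rewrite [X in _ + X]rnorm_distC (splitr e).
  by rewrite ltrD// ?(lt_trans sy me)// (lt_trans py me).
- apply: sub_countable (countableX cD (countableP setT)).
  exact: card_le_trans (subset_card_le (@subIsetr _ _ _)) (card_image_le _ _).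
Qed.

End separability.

(** * Measurability of the distance to a point *)

Section distance_measurability.
Context {R : realType} {d : measure_display} {X : measurableType d}.
Context {B : normedModType R[i]}.

(** If [u m] is close to [x], then [phi m], which norms [u m - y], almost norms
    [x - y]. Hence countably many functionals suffice on the closure of a
    countable set. The supremum is written [sups _ 0], the supremum of the tail
    that starts at index 0. *)
Lemma rnorm_eq_sup (u : nat -> B) (phi : nat -> dual B) (x y : B) :
  (forall m z, rnorm (phi m z : R[i]^o) <= rnorm z) ->
  (forall m, rnorm (phi m (u m - y) : R[i]^o) = rnorm (u m - y)) ->
  closure (range u) x ->
  rnorm (x - y) = sups (fun m => rnorm (phi m (x - y) : R[i]^o)) 0.
Proof.
move=> phi1 phiE /closure_rnormP ux; apply/eqP; rewrite eq_le; apply/andP; split.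
  apply/ler_addgt0Pr => e e0.
  have [|_ [m _ <-] xm] := ux (e / 2); first by rewrite divr_gt0.
  have : rnorm (phi m (x - y) : R[i]^o) <=
      sups (fun m => rnorm (phi m (x - y) : R[i]^o)) 0.
    apply: ub_le_sup; last by exists m.
    by exists (rnorm (x - y)) => _ [k _ <-]; exact: phi1.
  have := phi1 m (u m - x).
  have := ler_rnormD (phi m (u m - x) : R[i]^o) (phi m (x - y)).
  rewrite -linearD/= addrA subrK phiE [rnorm (u m - x)]rnorm_distC.
  have := ler_rdistD (u m) x y; lra.
apply: ge_sup; first by exists (rnorm (phi 0 (x - y) : R[i]^o)), 0.
by move=> _ [m _ <-]; exact: phi1.
Qed.

Lemma measurable_rnorm_sub (D : set X) (f : X -> B) (y : B)
    (u : nat -> B) (phi : nat -> dual B) (s : nat -> nat -> X -> R[i]^o) :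
  (forall m z, rnorm (phi m z : R[i]^o) <= rnorm z) ->
  (forall m, rnorm (phi m (u m - y) : R[i]^o) = rnorm (u m - y)) ->
  f @` D `<=` closure (range u) ->
  (forall m n, simple_function (s m n)) ->
  (forall m x, D x ->
    rnorm (s m n x - phi m (f x)) @[n --> \oo] --> (0 : R)) ->
  measurable_fun D (fun x => rnorm (f x - y)).
Proof.
move=> phi1 phiE fu ss sf.
pose h m x := rnorm (phi m (f x - y) : R[i]^o).
apply: (@eq_measurable_fun _ _ _ _ D (fun x => sups (h ^~ x) 0)).
  move=> x /set_mem Dx; rewrite (rnorm_eq_sup phi1 phiE)//.
  by apply: fu; exists x.
apply: measurable_fun_sups => [x Dx|m].
  by exists (rnorm (f x - y)) => _ [k _ <-]; exact: phi1.
apply: (@measurable_fun_cvg _ _ _ D (fun n x => rnorm (s m n x - phi m y))).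
  move=> n mD Y mY; apply: measurableI => //.
  exact: (measurable_simple_preimage [set z | Y (rnorm (z - phi m y))]).
move=> x Dx; apply/cvgrPdist_lt => e e0.
have /cvgrPdist_lt/(_ e e0) := sf m x Dx; apply: filterS => n.
rewrite sub0r normrN ger0_norm ?rnorm_ge0//; apply: le_lt_trans.
rewrite /h linearB/= ler_distl; apply/andP; split.
  have := ler_rdistD (s m n x) (phi m (f x)) (phi m y).
  have := ler_rdistD (phi m (f x)) (s m n x) (phi m y); rewrite [rnorm (phi m _ - s m n x)]rnorm_distC.
  lra.
have := ler_rdistD (s m n x) (phi m (f x)) (phi m y).
rewrite [rnorm (phi m _ - s m n x)]rnorm_distC; lra.
Qed.

End distance_measurability.

(** * Approximation by nearest points *)

Section nearest_point.
Context {R : realType} {d : measure_display} {X : measurableType d}.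
Context {B : normedModType R[i]}.
Variables (D : set X) (f : X -> B) (u : nat -> B).
Hypothesis mD : measurable D.
Hypothesis mf : forall m, measurable_fun D (fun x => rnorm (f x - u m)).

(** The distances from [f] are measurable on [D] only, so outside [D] they must
    not be compared: there the value stays at [u 0]. On [D] the value at stage
    [n + 1] is a point among [u 0, ..., u n] nearest to [f x], and each stage
    costs a single comparison. *)
Fixpoint nearest_point n (x : X) : B :=
  if n is n'.+1 then
    if x \in D `&` [set x | rnorm (f x - u n') < rnorm (f x - nearest_point n' x)]
    then u n' else nearest_point n' x
  else u 0%N.

Let closer n : set X :=
  D `&` [set x | rnorm (f x - u n) < rnorm (f x - nearest_point n x)].

Lemma measurable_closer n :
  measurable_fun D (fun x => rnorm (f x - nearest_point n x)) ->
  measurable (closer n).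
Proof.
move=> mg; have := measurable_fun_ltr (mf n) mg mD (Y := [set true]) Logic.I.
rewrite (_ : D `&` _ = closer n)//.
Qed.

(** The distance after a step is the minimum of the previous distance and the
    distance to the new point. *)
Lemma measurable_dist_nearest_point n :
  measurable_fun D (fun x => rnorm (f x - nearest_point n x)).
Proof.
elim: n => [|n IH]; first exact: mf.
apply: (@eq_measurable_fun _ _ _ _ D
  ((fun x => rnorm (f x - u n)) \min (fun x => rnorm (f x - nearest_point n x)))).
  move=> x xD; rewrite /= minElt.
  rewrite (_ : (x \in _) = (rnorm (f x - u n) < rnorm (f x - nearest_point n x))).
    by case: ifP.
  by apply/idP/idP => [/set_mem[]//|lt_n]; rewrite inE; split => //; exact/set_mem.
exact: measurable_minr.
Qed.

Lemma simple_function_nearest_point n : simple_function (nearest_point n).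
Proof.
elim: n => [|n IH]; first exact: simple_function_cst.
apply: simple_function_if => //; apply: measurable_closer.
exact: measurable_dist_nearest_point.
Qed.

Lemma dist_nearest_point_le n m x : D x -> (m < n)%N ->
  rnorm (f x - nearest_point n x) <= rnorm (f x - u m).
Proof.
move=> Dx; elim: n => // n IH; rewrite ltnS => mn /=.
have [/set_mem[_ /= lt_n]|notin] := boolP (x \in _); last first.
  have le_n : rnorm (f x - nearest_point n x) <= rnorm (f x - u n).
    by rewrite leNgt; apply: contra notin => lt_n; rewrite inE.
  by move: mn; rewrite leq_eqVlt => /predU1P[->|/IH].
move: mn; rewrite leq_eqVlt => /predU1P[->//|/IH]; apply: le_trans.
exact: ltW.
Qed.

Lemma cvg_nearest_point x : D x -> closure (range u) (f x) ->
  rnorm (nearest_point n x - f x) @[n --> \oo] --> (0 : R).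
Proof.
move=> Dx /closure_rnormP ux; apply/cvgrPdist_lt => e e0.
have [_ [m _ <-] fm] := ux e e0.
exists m.+1 => // n /= mn.
rewrite sub0r normrN ger0_norm ?rnorm_ge0// rnorm_distC.
exact: le_lt_trans (dist_nearest_point_le Dx mn) fm.
Qed.

End nearest_point.

Lemma countable_sub_range (T : pointedType) (D : set T) :
  countable D -> exists u : nat -> T, D `<=` range u.
Proof.
move=> /countable_injP[c cinj].
have /choice[u uP] (n : nat) : exists x, forall y, D y -> c y = n -> x = y.
  have [[x Dx cx]|nex] := pselect (exists2 x, D x & c x = n).
    by exists x => y Dy cy; apply: cinj; rewrite ?inE// cx cy.
  by exists point => y Dy cy; exfalso; apply: nex; exists y.
by exists u => x Dx; exists (c x) => //; exact: uP.
Qed.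

(** * The measurability theorem *)

Section pettis.
Context {R : realType} {d : measure_display} {X : measurableType d}.
Context {A : cstarAlgType R} {H : hilbertType R} (I : set X -> cp_map A H).
Implicit Type f : X -> A.

(** The values of all the approximations form a countable set whose closure
    contains the values of [f] off the null set. *)
Lemma strongly_measurable_essentially_separably_valued f :
  strongly_measurable I f -> essentially_separably_valued I f.
Proof.
move=> sf h k; have [g [gs [N [mN N0 gf]]]] := sf h k.
exists N; split => //; apply: (@separable_sub_closure _ _ (\bigcup_n range (g n))).
  apply: bigcup_countable; first exact: countableP.
  by move=> n _; apply: finite_set_countable; exact: simple_function_finite_range.
move=> _ [x Nx <-]; apply/closure_rnormP => e e0.
have /cvg_norm0P/cvgrPdist_lt/(_ e e0)[n _ /(_ n (leqnn n))] := gf x Nx.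
rewrite /= sub0r normrN ger0_norm ?rnorm_ge0// => gn.
by exists (g n x); [exists n => //; exists x|rewrite rnorm_distC].
Qed.

Lemma strongly_measurable_weakly_measurable f :
  strongly_measurable I f -> weakly_measurable I f.
Proof.
move=> sf phi h k; have [g [gs [N [mN N0 gf]]]] := sf h k.
exists (fun n => phi \o g n); split; first by move=> n; exact: simple_function_linear.
exists N; split => // x Nx; apply/cvg_norm0P/cvgrPdist_lt => e e0.
have [M M0 phiM] := bounded_op_bound phi.
have M1 : 0 < M + 1 by rewrite ltr_wpDl.
have /cvg_norm0P/cvgrPdist_lt/(_ (e / (M + 1))) := gf x Nx.
rewrite divr_gt0// => /(_ isT); apply: filterS => n.
rewrite !sub0r !normrN !ger0_norm ?rnorm_ge0// ltr_pdivlMr// mulrC.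
apply: le_lt_trans; rewrite /= -linearB/=; apply: le_trans (phiM _) _.
by rewrite ler_wpM2r ?rnorm_ge0// lerDl.
Qed.

(** The hard direction. Weak measurability is applied only to the countably many
    functionals [phi (j, m)] that norm the differences [u m - u j], so that the
    exceptional sets can be collected in one null set. *)
Lemma separable_weakly_strongly_measurable f : cp_instrument I ->
  essentially_separably_valued I f -> weakly_measurable I f ->
  strongly_measurable I f.
Proof.
move=> hI sf wf h k; have [E [mE E0 [C [cC _ fC]]]] := sf h k.
have [u Cu] := countable_sub_range cC.
have /choice[phi phiP] (z : nat * nat) := norming_functional (u z.2 - u z.1).
have /choice[s sP] z := wf (phi z) h k.
have /choice[N NP] z := (sP z).2.
(* [unpickle] enumerates the pairs; the default only repeats one of them. *)
pose M n := if n is n'.+1 then N (odflt (0, 0)%N (unpickle n')) else E.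
have MP n : measurable (M n) /\ semivariation (instrument_coef I h k) (M n) = 0%E.
  by case: n => [|n] //=; have [] := NP (odflt (0, 0)%N (unpickle n)).
pose T := \bigcup_n M n.
have mT : measurable T by apply: bigcup_measurable => n _; exact: (MP n).1.
have T0 : semivariation (instrument_coef I h k) T = 0%E.
  by apply: semivariation_bigcup_eq0 => // n; have [] := MP n.
have TE x : ~ T x -> ~ E x by move=> Tx Ex; apply: Tx; exists 0%N.
have TN z x : ~ T x -> ~ N z x.
  by move=> Tx Nx; apply: Tx; exists (pickle z).+1 => //=; rewrite pickleK.
have fu : f @` (~` T) `<=` closure (range u).
  move=> _ [x Tx <-]; apply: (closureS Cu); apply: fC; exists x => //; exact: TE.
have mf j : measurable_fun (~` T) (fun x => rnorm (f x - u j)).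
  apply: (@measurable_rnorm_sub _ _ _ _ _ _ _ u (fun m => phi (j, m)) (fun m => s (j, m))).
  - by move=> m; exact: (phiP (j, m)).1.
  - by move=> m; exact: (phiP (j, m)).2.
  - exact: fu.
  - by move=> m n; exact: (sP (j, m)).1.
  - move=> m x Tx; apply/cvg_norm0P; have [_ _] := NP (j, m); apply.
    exact: TN.
exists (nearest_point (~` T) f u); split.
  by move=> n; apply: simple_function_nearest_point => //; exact: measurableC.
exists T; split => // x Tx; apply/cvg_norm0P; apply: cvg_nearest_point => //.
by apply: fu; exists x.
Qed.

End pettis.

Theorem theorem3p16 (R : realType) (d : measure_display) (X : measurableType d)
    (A : cstarAlgType R) (H : hilbertType R) (I : set X -> cp_map A H)
    (hI : cp_instrument I) (f : X -> A) :
  strongly_measurable I f <->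
  essentially_separably_valued I f /\ weakly_measurable I f.
Proof.
split=> [sf|[sf wf]]; last exact: separable_weakly_strongly_measurable.
split; first exact: strongly_measurable_essentially_separably_valued.
exact: strongly_measurable_weakly_measurable.
Qed.
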